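(* There exists a constant $C>0$, not depending on $N$, $n$ or $w$, such that the following holds for every integer $N>100$. Let $m=(N+1)/2$ if $N$ is odd and $m=N/2$ if $N$ is even, let $x_1>x_2>\dots>x_N$ be the unique strictly decreasing solution with $x_1+\dots+x_N=0$ of the recursion $$x_{n+1}=x_n-\frac{1}{x_1+\cdots+x_n},\qquad 1\le n\le N-1,$$ let $h$ be the associated sawtooth function (see context), let $f_h$ be the unique bounded solution of the Stein equation $f'(w)-wf(w)=h(w)-\mathbb{E}h(Z)$, where $Z$ is a standard normal random variable, and let $g_h(w)=(wf_h(w))'$. If $n\ge 1$ is an integer and $w\in\mathbb{R}$ satisfies either $$x_{\lfloor m/e^3\rfloor}\le x_{n+1}<w\le x_n\qquad\text{or}\qquad -x_n\le w<-x_{n+1}\le -x_{\lfloor m/e^3\rfloor},$$ then $$|g_h(w)|\le C\left(\frac{1}{\log(m/n)}+\frac{1}{n^{2/9}}\right).$$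
   Context: It is known (McKeague and Levin) that the recursion has exactly one strictly decreasing solution with $x_1+\dots+x_N=0$; it satisfies $x_n=-x_{N+1-n}$ for $1\le n\le N$. The sawtooth function $h:\mathbb{R}\to\mathbb{R}$ associated with $x_1>\dots>x_N$ is defined, with midpoints $m_n=(x_n+x_{n+1})/2$ for $1\le n<N$, by $h(w)=0$ if $w\ge x_1$ or $w<x_N$; $h(w)=w-x_{n+1}$ if $x_{n+1}\le w<m_n$, $1\le n<N$; $h(w)=x_n-w$ if $m_n\le w<x_n$, $1\le n<N$. It is continuous and $1$-Lipschitz. The symbol $\log$ denotes the natural logarithm and $\lfloor x\rfloor$ the greatest integer at most $x$. *)

(* Defs.v *)
From HB Require Import structures.
From mathcomp Require Import all_boot all_order all_algebra.
From mathcomp Require Import all_classical all_reals all_analysis.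
Set Implicit Arguments.
Unset Strict Implicit.
Unset Printing Implicit Defensive.
Import Order.TTheory GRing.Theory Num.Theory.
Import numFieldNormedType.Exports.
Local Open Scope classical_set_scope.
Local Open Scope ring_scope.

(* x_1, ..., x_N are the values x 1, ..., x N of a sequence x : nat -> R;
   the values of x outside the range 1..N play no role. *)
Record decreasing_solution (R : realType) (N : nat) (x : nat -> R) : Prop := {
  solution_rec : forall n : nat, (1 <= n < N)%N ->
    x n.+1 = x n - 1 / (\sum_(1 <= k < n.+1) x k) ;
  solution_decr : forall n : nat, (1 <= n < N)%N -> x n.+1 < x n ;
  solution_sum0 : \sum_(1 <= k < N.+1) x k = 0
}.

Definition midpoint (R : realType) (x : nat -> R) (n : nat) : R :=
  (x n + x n.+1) / 2.

Definition tooth (R : realType) (x : nat -> R) (n : nat) (w : R) : R :=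
  if x n.+1 <= w < midpoint x n then w - x n.+1
  else if midpoint x n <= w < x n then x n - w
  else 0.

(* For a strictly decreasing x the intervals [x_{n+1}, x_n) are pairwise
   disjoint, so at most one summand is nonzero at a given w; the lemmas
   sawtooth_out, sawtooth_left and sawtooth_right below recover the usual
   definition by cases. *)
Definition sawtooth (R : realType) (N : nat) (x : nat -> R) (w : R) : R :=
  if (x 1%N <= w) || (w < x N) then 0
  else \sum_(1 <= n < N) tooth x n w.

Lemma sawtooth_out (R : realType) (N : nat) (x : nat -> R) (w : R) :
  (x 1%N <= w) || (w < x N) -> sawtooth N x w = 0.
Proof. by rewrite /sawtooth => ->. Qed.

Section sawtooth_cases.
Variables (R : realType) (N : nat) (x : nat -> R).
Hypothesis x_decr : forall n : nat, (1 <= n < N)%N -> x n.+1 < x n.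

Let x_le (i j : nat) : (1 <= i)%N -> (i <= j)%N -> (j <= N)%N -> x j <= x i.
Proof.
move=> i1 /subnK <-; elim: (j - i)%N => [//|d IH] dN.
apply: le_trans (IH (ltnW dN)); apply/ltW/x_decr.
by rewrite dN andbT (leq_trans i1)// leq_addl.
Qed.

Let tooth0 (n : nat) (w : R) :
  (1 <= n < N)%N -> (w < x n.+1) || (x n <= w) -> tooth x n w = 0.
Proof.
move=> /x_decr xn; have [xm mx] := midf_lt xn.
move=> /orP[wx|xw]; rewrite /tooth /midpoint (addrC (x n)).
  by rewrite leNgt wx/= leNgt (lt_trans wx xm).
by rewrite [w < x n]ltNge xw andbF (ltNge w) (le_trans (ltW mx) xw) andbF.
Qed.

Let sawtoothE (n : nat) (w : R) : (1 <= n < N)%N -> x n.+1 <= w < x n ->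
  sawtooth N x w = tooth x n w.
Proof.
move=> /[dup] n1N /andP[n1 nN] /andP[xw wx]; rewrite /sawtooth ifF; last first.
  apply/negbTE; rewrite negb_or -ltNge -leNgt.
  by rewrite (lt_le_trans wx (x_le _ n1 (ltnW nN)))//= (le_trans _ xw)// x_le.
have nin : n \in index_iota 1 N by rewrite mem_index_iota.
rewrite (bigD1_seq n)//= ?iota_uniq// big_nat_cond big1 ?addr0// => k.
move=> /andP[/andP[k1 kN] kn]; apply: tooth0; rewrite ?k1//.
move: kn; rewrite neq_ltn => /orP[kn|nk]; apply/orP; [left|right].
  by rewrite (lt_le_trans wx)// x_le// ltnW.
by apply: le_trans xw; apply: x_le => //; exact: ltnW.
Qed.

Lemma sawtooth_left (n : nat) (w : R) : (1 <= n < N)%N ->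
  x n.+1 <= w < midpoint x n -> sawtooth N x w = w - x n.+1.
Proof.
move=> nN xwm; have [_ mx] := midf_lt (x_decr nN).
case/andP: (xwm) => xw wm; rewrite (sawtoothE nN) /tooth ?xwm//.
by rewrite xw (lt_trans wm)// /midpoint addrC.
Qed.

Lemma sawtooth_right (n : nat) (w : R) : (1 <= n < N)%N ->
  midpoint x n <= w < x n -> sawtooth N x w = x n - w.
Proof.
move=> nN mwx; have [xm _] := midf_lt (x_decr nN).
case/andP: (mwx) => mw wx; rewrite (sawtoothE nN) /tooth ?mwx//.
  by rewrite ltNge mw andbF.
by rewrite wx andbT (le_trans _ mw)// ltW// /midpoint addrC.
Qed.

End sawtooth_cases.

Definition standard_normal (R : realType) (d : measure_display)
    (T : measurableType d) (P : probability T R) (Z : {RV P >-> R}) : Prop :=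
  forall A : set R, measurable A -> distribution P Z A = normal_prob 0 1 A.

(* The Stein equation f' - w f = h - c is required at every real w, with f
   differentiable on the whole line; c is the expectation of h(Z). *)
Record bounded_stein_solution (R : realType) (h : R -> R) (c : R) (f : R -> R) :
    Prop := {
  stein_bounded : exists M : R, forall w : R, `|f w| <= M ;
  stein_derivable : forall w : R, derivable f w 1 ;
  stein_equation : forall w : R, derive1 f w - w * f w = h w - c
}.

(* Main.v *)
Require Import Defs.
From HB Require Import structures.
From mathcomp Require Import all_boot all_order all_algebra.
From mathcomp Require Import all_classical all_reals all_analysis.
From mathcomp Require Import ring lra zify.
Set Implicit Arguments.
Unset Strict Implicit.
Unset Printing Implicit Defensive.
Import Order.TTheory GRing.Theory Num.Theory.
Import numFieldNormedType.Exports.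
Local Open Scope classical_set_scope.
Local Open Scope ring_scope.

(** Write S_n = x_1 + ... + x_n and u = e^{-t^2/2} f_h, so that
    u' = e^{-t^2/2} (h - c) with c = E h(Z), and
    g_h(w) = (1 + w^2) f_h(w) + w (h(w) - c).  Comparing u for w > 0 with
    c e^{-t^2/2} / t and with c e^{-t^2/2} t / (1 + t^2), which only uses the mean
    value theorem and u -> 0 at infinity, gives
      - (1 + w^2) e^{w^2/2} E <= g_h(w) <= c / w + w h(w),
    where E bounds the integral of h e^{-t^2/2} over t >= w, tooth by tooth.
    As h <= 1 / (2 S_j) on [x_{j+1}, x_j] and S_j >= j x_j, the upper bound is at
    most 1 / (2 x_{n+1}^2) + 1 / (2 n).  For the lower bound, S_j e^{x_j^2/2} is
    nonincreasing in j, so e^{w^2/2} E is at most the sum over j <= n of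
    1 / (S_j S_n), that is O(n^{-1/2} / x_n^2).
    Finally x_{n+1}^2 is at least of order log (m/n): the sum of the x_i^2 is N - 1,
    hence S_n^2 <= n N by Cauchy-Schwarz, while 2 S_m^2 >= m (m - 1) because the
    gaps 1 / S_j, j < m, are at least 1 / S_m; now compare S_n e^{x_n^2/2} with S_m.
    Negative w reduce to positive ones by the symmetry x_n = - x_{N+1-n}. *)

(** * Partial sums: uniqueness and symmetry of the solution *)

Definition psum (R : realType) (x : nat -> R) (n : nat) : R :=
  \sum_(1 <= k < n.+1) x k.

Lemma psum0 (R : realType) (x : nat -> R) : psum x 0 = 0.
Proof. by rewrite /psum big_geq. Qed.

Lemma psumS (R : realType) (x : nat -> R) (n : nat) :
  psum x n.+1 = psum x n + x n.+1.
Proof. by rewrite /psum big_nat_recr. Qed.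

Section DecreasingSolution.
Variables (R : realType) (N : nat).
Implicit Types x y : nat -> R.

Lemma psum_gt0 x n : decreasing_solution N x -> (1 <= n < N)%N -> 0 < psum x n.
Proof.
move=> sol nN; have := solution_decr sol nN; rewrite (solution_rec sol nN).
by rewrite ltrBlDr ltrDl div1r invr_gt0.
Qed.

Lemma solution_gap x n : decreasing_solution N x -> (1 <= n < N)%N ->
  x n - x n.+1 = (psum x n)^-1.
Proof. by move=> sol nN; rewrite (solution_rec sol nN) div1r opprB addrC subrK. Qed.

Lemma solution_le x i j : decreasing_solution N x ->
  (1 <= i)%N -> (i <= j)%N -> (j <= N)%N -> x j <= x i.
Proof.
move=> sol i1 /subnK <-; elim: (j - i)%N => [//|d IH] dN.
apply: le_trans (IH (ltnW dN)); apply/ltW/(solution_decr sol).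
by rewrite dN andbT (leq_trans i1)// leq_addl.
Qed.

Lemma solution_lt x i j : decreasing_solution N x ->
  (1 <= i)%N -> (i < j)%N -> (j <= N)%N -> x j < x i.
Proof.
move=> sol i1 ij jN; apply: (le_lt_trans (solution_le sol _ ij jN)) => //.
by apply: (solution_decr sol); rewrite i1 (leq_trans ij jN).
Qed.

(* A larger initial value gives larger partial sums, hence smaller gaps, so it
   stays ahead and the total sum cannot vanish for both. *)
Lemma solution_first_le x y : (0 < N)%N ->
  decreasing_solution N x -> decreasing_solution N y -> x 1%N <= y 1%N.
Proof.
move=> N0 sx sy; rewrite leNgt; apply/negP => yx.
have H n : (n < N)%N -> y n.+1 < x n.+1 /\ psum y n.+1 < psum x n.+1.
  elim: n => [_|n IH nN]; first by rewrite !psumS !psum0 !add0r.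
  have [yxn Syx] := IH (ltnW nN).
  have n1N : (1 <= n.+1 < N)%N by [].
  have xyn : y n.+2 < x n.+2.
    have gx := solution_gap sx n1N; have gy := solution_gap sy n1N.
    have : (psum x n.+1)^-1 <= (psum y n.+1)^-1.
      by rewrite lef_pV2 ?posrE ?(psum_gt0 _ n1N)// ltW.
    by lra.
  by split => //; rewrite (psumS y n.+1) (psumS x n.+1) ltrD.
have [|_] := H N.-1; first by rewrite prednK.
rewrite prednK// /psum (solution_sum0 sx) (solution_sum0 sy).
by rewrite ltxx.
Qed.

(** Comparing first terms both ways makes them equal; the recursion then carries equality of term
    and partial sum along together. *)
Lemma solution_unique x y n :
  decreasing_solution N x -> decreasing_solution N y ->
  (1 <= n <= N)%N -> x n = y n.
Proof.
move=> sx sy; case: n => // n /= nN; have N0 : (0 < N)%N by lia.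
suff [] : x n.+1 = y n.+1 /\ psum x n.+1 = psum y n.+1 by [].
elim: n nN => [_|n IH nN].
  rewrite !psumS !psum0 !add0r.
  by have -> : x 1%N = y 1%N by apply/eqP; rewrite eq_le !solution_first_le.
have [xy Sxy] := IH (ltnW nN).
have xyn : x n.+2 = y n.+2.
  have := @solution_gap x n.+1 sx nN; have := @solution_gap y n.+1 sy nN.
  by rewrite Sxy xy; lra.
by split => //; rewrite (psumS x n.+1) (psumS y n.+1) Sxy xyn.
Qed.

(** Since the total is zero, minus the sum of the last [n] terms is the sum of the first [N - n].
    Hence the reversed, negated sequence obeys the same recursion, and uniqueness yields
    antisymmetry. *)
Lemma psum_rev x n : (n <= N)%N -> psum x N = 0 ->
  psum (fun k => - x (N.+1 - k)%N) n = psum x (N - n).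
Proof.
move=> nN S0; elim: n nN => [_|n IH nN]; first by rewrite psum0 subn0 S0.
rewrite psumS IH; last exact: ltnW.
have -> : (N - n = (N - n.+1).+1)%N by lia.
rewrite psumS; have -> : (N.+1 - n.+1 = (N - n.+1).+1)%N by lia.
by rewrite addrK.
Qed.

Lemma solution_rev x : decreasing_solution N x ->
  decreasing_solution N (fun k => - x (N.+1 - k)%N).
Proof.
move=> sol; have S0 : psum x N = 0 := solution_sum0 sol; split.
- move=> n nN; rewrite -/(psum _ _) psum_rev//; last lia.
  have := @solution_gap x (N - n) sol; rewrite div1r.
  have -> : (N.+1 - n.+1 = N - n)%N by lia.
  have -> : (N.+1 - n = (N - n).+1)%N by lia.
  by move=> /(_ ltac:(lia)) <-; lra.
- move=> n nN; rewrite ltrN2; apply: (solution_lt sol); lia.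
- by rewrite -/(psum _ _) psum_rev// subnn psum0.
Qed.

Lemma solution_antisym x n : decreasing_solution N x -> (1 <= n <= N)%N ->
  x n = - x (N.+1 - n)%N.
Proof. by move=> sol; apply: solution_unique (solution_rev sol). Qed.

Lemma psum_sym x n : decreasing_solution N x -> (n <= N)%N ->
  psum x (N - n) = psum x n.
Proof.
move=> sol nN; rewrite -psum_rev//; last exact: (solution_sum0 sol).
rewrite /psum; apply: eq_big_nat => k kn.
by rewrite [RHS]solution_antisym//; lia.
Qed.

(** In the first half, [x n] is at least its mirror term, which is [- x n]. *)
Lemma solution_ge0 x n : decreasing_solution N x ->
  (1 <= n)%N -> (n.*2 <= N.+1)%N -> (n <= N)%N -> 0 <= x n.
Proof.
move=> sol n1 nN n'N; have xn : x n = - x (N.+1 - n)%N.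
  by apply: solution_antisym => //; rewrite n1.
have : x (N.+1 - n)%N <= x n by apply: (solution_le sol); lia.
by lra.
Qed.

(** * Growth of the partial sums and lower bounds on the terms *)

Lemma psum_le x i j : decreasing_solution N x ->
  (i <= j)%N -> (j.*2 <= N.+1)%N -> (j <= N)%N -> psum x i <= psum x j.
Proof.
move=> sol /subnK <-; elim: (j - i)%N => [//|d IH] dN dN'.
rewrite addSn psumS (le_trans (IH _ _)) ?lerDl ?solution_ge0//; lia.
Qed.

Lemma ler_natM_psum x n : decreasing_solution N x -> (n <= N)%N ->
  n%:R * x n <= psum x n.
Proof.
move=> sol; elim: n => [|n IH nN]; first by rewrite mul0r psum0.
rewrite psumS mulrSr mulrDl mul1r lerD2r.
case: n IH nN => [|n] IH nN; first by rewrite mul0r psum0.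
by apply: le_trans (IH (ltnW nN)); rewrite ler_wpM2l// ltW// (solution_decr sol).
Qed.

(* As [S_{n+1} / S_n = 1 + x_{n+1} (x_n - x_{n+1})], this is [1 + t <= e^t]: the
   partial sums behave like a Gaussian density at [x_n]. *)
Lemma psum_expR_step x n : decreasing_solution N x -> (1 <= n < N)%N ->
  psum x n.+1 * expR (x n.+1 ^+ 2 / 2) <= psum x n * expR (x n ^+ 2 / 2).
Proof.
move=> sol nN; have S0 := psum_gt0 sol nN; have gap := solution_gap sol nN.
have -> : x n ^+ 2 / 2 = (x n ^+ 2 - x n.+1 ^+ 2) / 2 + x n.+1 ^+ 2 / 2 by lra.
rewrite expRD mulrA ler_wpM2r ?expR_ge0// psumS.
apply: (@le_trans _ _ (psum x n * (1 + (x n ^+ 2 - x n.+1 ^+ 2) / 2))); last first.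
  by rewrite ler_wpM2l ?expR_ge1Dx// ltW.
rewrite mulrDr mulr1 lerD2l.
have Sg : psum x n * (x n - x n.+1) = 1 by rewrite gap mulfV// gt_eqF.
have -> : psum x n * ((x n ^+ 2 - x n.+1 ^+ 2) / 2)
    = psum x n * (x n - x n.+1) * ((x n + x n.+1) / 2) by field.
have : x n.+1 < x n by exact: (solution_decr sol).
by rewrite Sg; lra.
Qed.

Lemma psum_expR_le x i j : decreasing_solution N x ->
  (1 <= i)%N -> (i <= j)%N -> (j <= N)%N ->
  psum x j * expR (x j ^+ 2 / 2) <= psum x i * expR (x i ^+ 2 / 2).
Proof.
move=> sol i1 /subnK <-; elim: (j - i)%N => [//|d IH] dN.
by apply: le_trans (IH (ltnW dN)); apply: (@psum_expR_step x (d + i) sol); lia.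
Qed.

(** The sum telescopes: from S_n (x_n - x_{n+1}) = 1 one gets x_{n+1}^2 = S_{n+1} x_{n+1} - S_n x_n
    + 1. With n + 1 = N and S_N = 0 the total is N - 1. *)
Lemma sum_sqr_solution x n : decreasing_solution N x -> (n < N)%N ->
  psum (fun k => x k ^+ 2) n.+1 = psum x n.+1 * x n.+1 + n%:R.
Proof.
move=> sol; elim: n => [_|n IH nN].
  by rewrite !psumS !psum0 !add0r addr0 expr2.
have nN' : (1 <= n.+1 < N)%N by [].
rewrite (psumS _ n.+1) IH ?(ltnW nN)// (psumS x n.+1).
have : psum x n.+1 * (x n.+1 - x n.+2) = 1.
  by rewrite (solution_gap sol nN') mulfV// gt_eqF// psum_gt0.
by rewrite -natr1; lra.
Qed.

Lemma sqr_psum_le x n :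
  psum x n ^+ 2 <= n%:R * psum (fun k => x k ^+ 2) n.
Proof.
elim: n => [|n IH]; first by rewrite !psum0 mul0r expr0n.
rewrite !psumS -natr1; set S := psum x n in IH *; set A := psum _ n in IH *.
have A0 : 0 <= A by rewrite /A /psum sumr_ge0// => k _; exact: sqr_ge0.
suff : 2 * S * x n.+1 <= A + n%:R * x n.+1 ^+ 2 by lra.
have [n0|n0] := posnP n.
  by rewrite /S n0 psum0; rewrite mulr0 !mul0r addr0.
have n0R : 0 < n%:R :> R by rewrite ltr0n.
(* After multiplication by n, the induction hypothesis S^2 <= n A leaves only (S - n x_{n+1})^2 >=
   0. *)
rewrite -(ler_pM2l n0R); have := sqr_ge0 (S - n%:R * x n.+1); lra.
Qed.

Lemma sqr_psum_le_nat x n : decreasing_solution N x -> (n <= N)%N ->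
  psum x n ^+ 2 <= n%:R * N%:R.
Proof.
move=> sol nN; apply: (le_trans (sqr_psum_le x n)); rewrite ler_wpM2l//.
case: (posnP N) => [N0|N0].
  by move: nN; rewrite {1}N0 leqn0 => /eqP ->; rewrite psum0 ler0n.
have : psum (fun k => x k ^+ 2) N = N.-1%:R.
  have {1}-> : N = N.-1.+1 by lia.
  rewrite sum_sqr_solution//; last lia.
  by rewrite prednK// [psum x N](solution_sum0 sol) mul0r add0r.
have : psum (fun k => x k ^+ 2) n <= psum (fun k => x k ^+ 2) N.
  rewrite -(subnK nN); elim: (N - n)%N => // d IH.
  by rewrite addSn psumS (le_trans IH)// lerDl sqr_ge0.
have : N.-1%:R <= N%:R :> R by rewrite ler_nat leq_pred.
by lra.
Qed.

(** Going back i steps from x_m >= 0 crosses i gaps 1 / S_j with S_j <= S_m, each at least 1 /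
    S_m. *)
Lemma solution_ge_psum x m i : decreasing_solution N x ->
  (m.*2 <= N.+1)%N -> (m < N)%N -> (i < m)%N -> i%:R <= x (m - i)%N * psum x m.
Proof.
move=> sol mN mN'; elim: i => [m0|i IH im].
  rewrite subn0; apply: mulr_ge0; first by apply: (solution_ge0 sol); lia.
  by apply/ltW/(psum_gt0 sol); lia.
have Sm : 0 < psum x m by apply: (psum_gt0 sol); lia.
have iN : (1 <= m - i.+1 < N)%N by lia.
have := IH (ltnW im); have := solution_gap sol iN.
have -> : ((m - i.+1).+1 = m - i)%N by lia.
move=> gap IHi; have S0 := psum_gt0 sol iN.
have : 1 <= (psum x (m - i.+1))^-1 * psum x m.
  rewrite mulrC ler_pdivlMr// mul1r; apply: (psum_le sol); lia.
by rewrite -gap -natr1; lra.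
Qed.

Lemma psum_mid_ge x m : decreasing_solution N x ->
  (m.*2 <= N.+1)%N -> (m < N)%N -> m%:R * (m%:R - 1) <= 2 * psum x m ^+ 2.
Proof.
move=> sol mN mN'.
(* The left-hand side is twice the sum of m - k over k = 1, ..., j, and each m - k is at most x_k
   S_m by [solution_ge_psum]. *)
suff H j : (j <= m)%N ->
    j%:R * (2 * m%:R - j%:R - 1) <= 2 * (psum x j * psum x m).
  by have := H m (leqnn _); rewrite -expr2; lra.
elim: j => [|j IH jm]; first by rewrite psum0 !mul0r mulr0.
have := IH (ltnW jm); rewrite psumS -(natr1 j).
have jm' : (m - j.+1 < m)%N by lia.
have := solution_ge_psum sol mN mN' jm'.
have -> : (m - (m - j.+1) = j.+1)%N by lia.
rewrite natrB// -(natr1 j); lra.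
Qed.

(** The chain is m (m - 1) <= 2 S_m^2 <= 2 S_n^2 e^{x_n^2} <= 4 n m e^{x_n^2}, where the last step
    uses S_n^2 <= n N and N <= 2 m; then m cancels. *)
Lemma expR_sqr_solution_ge x m n : decreasing_solution N x ->
  (N <= m.*2)%N -> (m.*2 <= N.+1)%N -> (m < N)%N -> (1 <= n <= m)%N ->
  m%:R - 1 <= 4 * n%:R * expR (x n ^+ 2).
Proof.
move=> sol Nm mN mN' nm; have m0 : 0 < m%:R :> R by rewrite ltr0n; lia.
rewrite -(ler_pM2l m0).
have Sn : 0 < psum x n by apply: (psum_gt0 sol); lia.
have Sm : 0 < psum x m by apply: (psum_gt0 sol); lia.
have H1 := psum_mid_ge sol mN mN'.
have H2 : psum x m <= psum x n * expR (x n ^+ 2 / 2).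
  apply: (le_trans _ (@psum_expR_le x n m sol _ _ _)); [|lia..].
  by rewrite -[leLHS]mulr1 ler_wpM2l ?(ltW Sm)// -expR0 ler_expR divr_ge0 ?sqr_ge0.
have H3 : psum x m ^+ 2 <= psum x n ^+ 2 * expR (x n ^+ 2).
  have -> : expR (x n ^+ 2) = expR (x n ^+ 2 / 2) ^+ 2.
    by rewrite [RHS]expr2 -expRD; congr expR; lra.
  by rewrite -exprMn lerXn2r// nnegrE ltW// mulr_gt0 ?expR_gt0.
have H4 : psum x n ^+ 2 <= n%:R * (2 * m%:R).
  apply: (le_trans (sqr_psum_le_nat sol _)); first lia.
  by rewrite ler_wpM2l// -natrM ler_nat mul2n.
have := ler_wpM2r (expR_ge0 (x n ^+ 2)) H4; lra.
Qed.

End DecreasingSolution.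

(** * Mean value inequality, decay at infinity, Gaussian weight *)

Lemma increment_le (R : realType) (F dF : R -> R) (a b K : R) : a <= b ->
  (forall t, a <= t <= b -> is_derive t 1 F (dF t)) ->
  (forall t, a <= t <= b -> dF t <= K) -> F b - F a <= K * (b - a).
Proof.
move=> ab FdF dFK; have [||c cab ->] := @MVT_segment R F dF a b ab.
- by move=> t; rewrite in_itv/= => /andP[/ltW at_ /ltW tb]; apply: FdF; rewrite at_.
- apply: derivable_within_continuous => t; rewrite in_itv/= => tab.
  by have [] := FdF t tab.
- by rewrite ler_wpM2r ?subr_ge0// dFK//; move: cab; rewrite in_itv.
Qed.

(** This replaces a passage to the limit: boundary terms at t will be bounded by M / t with t
    arbitrarily large. *)
Lemma le0_le_div (R : realType) (a M T : R) :
  (forall t, T <= t -> 0 < t -> a <= M / t) -> a <= 0.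
Proof.
move=> H; rewrite leNgt; apply/negP => a0.
pose t := Num.max T (`|M| / a + 1).
have t1 : `|M| / a + 1 <= t by rewrite le_max lexx orbT.
have t0 : 0 < t.
  by apply: lt_le_trans t1; rewrite ltr_wpDl// divr_ge0// ltW.
have := H t; rewrite le_max lexx => /(_ isT t0); rewrite ler_pdivlMr//.
suff : M < a * t by rewrite ltNge => /negP.
apply: (le_lt_trans (ler_norm M)).
apply: (@lt_le_trans _ _ (a * (`|M| / a + 1))); last by rewrite ler_pM2l.
by rewrite mulrDr mulr1 mulrCA mulfV ?gt_eqF// mulr1 ltrDl.
Qed.

Definition gauss (R : realType) (t : R) : R := expR (- (t ^+ 2 / 2)).

Section Gauss.
Variable R : realType.
Implicit Types t s : R.

Lemma gauss_gt0 t : 0 < gauss t. Proof. exact: expR_gt0. Qed.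

Lemma gauss_le_inv t : 0 < t -> gauss t <= 1 / t.
Proof.
move=> t0; rewrite /gauss expRN -div1r; apply: ler_wpM2l => //.
rewrite lef_pV2 ?posrE ?expR_gt0//; apply: le_trans (expR_ge1Dx _).
by have := sqr_ge0 (t - 1); lra.
Qed.

Lemma gauss_decr s t : 0 <= s -> s <= t -> gauss t <= gauss s.
Proof.
move=> s0 st; rewrite ler_expR lerN2 ler_pM2r ?invr_gt0//.
by rewrite lerXn2r// nnegrE// (le_trans s0).
Qed.

Lemma is_derive_gauss t : is_derive t 1 (@gauss R) (- t * gauss t).
Proof.
pose q (s : R) := - (s ^+ 2 / 2).
have Dq : is_derive t 1 q (- t).
  have D := is_deriveN (is_deriveM (is_deriveX 2 (is_derive_id t 1))
    (is_derive_cst (2^-1 : R) t 1)).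
  apply: (is_derive_eq D).
  by rewrite /= !scaler1 /GRing.scale/=; lra.
have := is_derive1_comp (is_derive_expR (q t)) Dq; rewrite mulrC; exact.
Qed.

Lemma is_derive_gaussM (r : R -> R) t dr : is_derive t 1 r dr ->
  is_derive t 1 (fun s => gauss s * r s) (gauss t * (dr - t * r t)).
Proof.
move=> Dr; apply: (is_derive_eq (is_deriveM (is_derive_gauss t) Dr)).
by rewrite /GRing.scale/=; ring.
Qed.

End Gauss.

(** * One-sided bounds for the bounded Stein solution *)

Section SteinSolution.
Variables (R : realType) (h : R -> R) (c : R) (f : R -> R).
Hypothesis sol : bounded_stein_solution h c f.
Hypothesis h0 : forall t, 0 <= h t.
Hypothesis c0 : 0 <= c.

Lemma is_derive_stein (t : R) : is_derive t 1 f (t * f t + (h t - c)).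
Proof.
apply: DeriveDef; first exact: (stein_derivable sol).
by rewrite -derive1E; have := stein_equation sol t; lra.
Qed.

Lemma derive1_id_stein (w : R) :
  derive1 (fun t : R => t * f t) w = (1 + w ^+ 2) * f w + w * (h w - c).
Proof.
rewrite derive1E.
have D := is_deriveM (is_derive_id w 1) (is_derive_stein w).
rewrite (@derive_val _ _ _ _ _ (fun t : R => t * f t) _ D) /GRing.scale/=; ring.
Qed.

(** The function [gauss t * (c / t - f t)] has derivative [- gauss t * (c / t ^+ 2 + h t)], so it is
    nonincreasing; at large t it is at least - M / t, hence it is nonnegative everywhere on t >
    0. *)
Lemma stein_le (w : R) : 0 < w -> f w <= c / w.
Proof.
move=> w0; pose r (t : R) := c * t^-1 - f t.
have Dr (t : R) : 0 < t -> is_derive t 1 r (- (c / t ^+ 2) - (t * f t + (h t - c))).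
  move=> t0; have t_neq0 : t != 0 by rewrite gt_eqF.
  have DV : is_derive t 1 (fun s : R => s^-1) (- t ^- 2 *: 1).
    exact: is_deriveV (is_derive_id t 1).
  apply: (is_derive_eq (is_deriveB (is_deriveZ c DV) (is_derive_stein t))).
  by rewrite /GRing.scale/=; field.
have [M fM] := stein_bounded sol.
suff : - (gauss w * r w) <= 0.
  by rewrite oppr_le0 pmulr_rge0 ?gauss_gt0// subr_ge0.
apply: (@le0_le_div _ _ M w) => t wt t0.
have := @increment_le _ _ _ w t 0 wt
  (fun s ws => is_derive_gaussM (Dr s (lt_le_trans w0 (andP ws).1))).
rewrite mul0r => H; have {H} : gauss t * r t - gauss w * r w <= 0.
  apply: H => s /andP[ws _]; have s0 := lt_le_trans w0 ws.
  rewrite pmulr_rle0 ?gauss_gt0// /r.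
  have -> : - (c / s ^+ 2) - (s * f s + (h s - c)) - s * (c / s - f s)
      = - (c / s ^+ 2 + h s) by field; rewrite gt_eqF.
  by rewrite oppr_le0 addr_ge0// divr_ge0// sqr_ge0.
have M0 : 0 <= M := le_trans (normr_ge0 _) (fM t).
have : gauss t * f t <= M / t.
  apply: (@le_trans _ _ (gauss t * M)).
    by rewrite ler_pM2l ?gauss_gt0// (le_trans (ler_norm _)).
  by rewrite mulrC ler_wpM2l// -div1r gauss_le_inv.
have : 0 <= gauss t * (c / t) by rewrite mulr_ge0 ?divr_ge0// ltW// gauss_gt0.
by rewrite /r; lra.
Qed.

(* [t / (1 + t^2)] is the classical lower bound for the Mills ratio, which makes
   the derivative of [gauss * stein_excess] at most [gauss * h]. *)
Definition stein_excess (t : R) : R := f t - c * (t / (1 + t ^+ 2)).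

Lemma is_derive_stein_excess (t : R) :
  is_derive t 1 stein_excess
    (t * f t + (h t - c) - c * ((1 - t ^+ 2) / (1 + t ^+ 2) ^+ 2)).
Proof.
have q0 : 1 + t ^+ 2 != 0 by rewrite gt_eqF// ltr_wpDr// sqr_ge0.
have Dq : is_derive t 1 (fun s : R => 1 + s ^+ 2) (2 * t).
  apply: (is_derive_eq (is_deriveD (is_derive_cst (1 : R) t 1)
    (is_deriveX 2 (is_derive_id t 1)))).
  by rewrite /GRing.scale/=; ring.
have DV := @is_deriveV R (fun s : R => 1 + s ^+ 2) t _ 1 q0 Dq.
apply: (is_derive_eq (is_deriveB (is_derive_stein t)
  (is_deriveZ c (is_deriveM (is_derive_id t 1) DV)))).
by rewrite /GRing.scale/=; field.
Qed.

Lemma stein_excess_increment_le (a b K : R) : 0 <= a -> a <= b -> 0 <= K ->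
  (forall t, a <= t <= b -> h t <= K) ->
  gauss b * stein_excess b - gauss a * stein_excess a <= gauss a * K * (b - a).
Proof.
move=> a0 ab K0 hK.
apply: (increment_le ab (fun t _ => is_derive_gaussM (is_derive_stein_excess t))).
move=> t /[dup] tab /andP[at_ tb].
(* On [a, b] with a >= 0 the weight is largest at the left end. *)
apply: (@le_trans _ _ (gauss t * K)); last by rewrite ler_wpM2r// gauss_decr.
rewrite ler_pM2l ?gauss_gt0//; apply: le_trans (hK t tab).
have q0 : 0 < 1 + t ^+ 2 by rewrite ltr_wpDr// sqr_ge0.
have -> : t * f t + (h t - c) - c * ((1 - t ^+ 2) / (1 + t ^+ 2) ^+ 2)
    - t * stein_excess t = h t - c * (2 / (1 + t ^+ 2) ^+ 2).
  by rewrite /stein_excess; field; rewrite gt_eqF.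
by rewrite gerBl mulr_ge0// divr_ge0// exprn_ge0// ltW.
Qed.

(** Beyond the last tooth the increment bound applies with K = 0, so [gauss * stein_excess] is
    nonincreasing there, while boundedness of [f] makes it vanish at infinity. *)
Lemma stein_excess_ge0 (a : R) : 0 <= a -> (forall t, a <= t -> h t = 0) ->
  0 <= stein_excess a.
Proof.
move=> a0 ha; rewrite -(pmulr_rge0 _ (gauss_gt0 a)) -oppr_le0.
have [M fM] := stein_bounded sol.
have M0 : 0 <= M := le_trans (normr_ge0 _) (fM 0).
apply: (@le0_le_div _ _ (M + c) a) => t at_ t0.
have := @stein_excess_increment_le a t 0 a0 at_ (lexx _).
rewrite mulr0 mul0r => H.
have {H} : gauss t * stein_excess t - gauss a * stein_excess a <= 0.
  by apply: H => s /andP[as_ _]; rewrite ha.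
have : - (gauss t * stein_excess t) <= (M + c) / t.
  apply: (@le_trans _ _ (gauss t * (M + c))); last first.
    by rewrite mulrC ler_wpM2l ?addr_ge0// -div1r gauss_le_inv.
  rewrite -mulrN ler_pM2l ?gauss_gt0// /stein_excess opprB addrC lerD//.
    by rewrite (le_trans (ler_norm _))// normrN.
  rewrite -[leRHS]mulr1 ler_wpM2l// ler_pdivrMr ?ltr_wpDr ?sqr_ge0// mul1r.
  by have := sqr_ge0 (t - 1); lra.
by lra.
Qed.

End SteinSolution.

(** * Height and reflection of the sawtooth function *)

Section Sawtooth.
Variables (R : realType) (N : nat) (x : nat -> R).
Hypothesis sol : decreasing_solution N x.

Lemma sawtooth_ge0 (w : R) : 0 <= sawtooth N x w.
Proof.
rewrite /sawtooth; case: ifP => // _; apply: sumr_ge0 => n _; rewrite /tooth.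
case: ifP => [/andP[xw _]|_]; first by rewrite subr_ge0.
by case: ifP => [/andP[_ /ltW wx]|_] //; rewrite subr_ge0.
Qed.

Lemma sawtooth_node (n : nat) : (1 <= n <= N)%N -> sawtooth N x (x n) = 0.
Proof.
move=> /andP[n1 nN]; have [n2|n2] := leqP n 1.
  have -> : n = 1%N by lia.
  by rewrite sawtooth_out// lexx.
have nN' : (1 <= n.-1 < N)%N by lia.
have nE : n.-1.+1 = n by lia.
have := solution_decr sol nN'; rewrite nE => xn.
rewrite (sawtooth_left (solution_decr sol) nN') nE ?subrr//.
by rewrite lexx /midpoint nE /=; lra.
Qed.

(** A tooth peaks at the midpoint, at half the gap 1 / S_n. *)
Lemma sawtooth_le_gap (n : nat) (w : R) : (1 <= n < N)%N ->
  x n.+1 <= w <= x n -> sawtooth N x w <= (psum x n)^-1 / 2.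
Proof.
move=> nN /andP[xw wx]; rewrite -(solution_gap sol nN).
have xn := solution_decr sol nN.
move: wx; rewrite le_eqVlt => /predU1P[->|wx].
  by rewrite sawtooth_node; [lra|lia].
have [wm|mw] := ltP w (midpoint x n).
  rewrite (sawtooth_left (solution_decr sol) nN) ?xw//.
  by move: wm; rewrite /midpoint; lra.
rewrite (sawtooth_right (solution_decr sol) nN) ?mw//.
by move: mw; rewrite /midpoint; lra.
Qed.

(** Reflection sends tooth n to tooth N - n, and S_{N-n} = S_n. *)
Lemma sawtooth_opp_le_gap (n : nat) (w : R) : (1 <= n < N)%N ->
  x n.+1 <= w <= x n -> sawtooth N x (- w) <= (psum x n)^-1 / 2.
Proof.
move=> nN wn; rewrite -(psum_sym sol (n := n)); last lia.
apply: sawtooth_le_gap; first lia.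
rewrite (solution_antisym sol (n := (N - n).+1)); last lia.
rewrite (solution_antisym sol (n := N - n)); last lia.
have -> : (N.+1 - (N - n).+1 = n)%N by lia.
have -> : (N.+1 - (N - n) = n.+1)%N by lia.
by rewrite !lerN2 andbC.
Qed.

Lemma sawtooth_opp_out (w : R) : (0 < N)%N -> x 1%N <= w ->
  sawtooth N x (- w) = 0.
Proof.
move=> N0 xw; have xN : x N = - x 1%N.
  by rewrite (solution_antisym sol (n := N)) ?subSnn//; lia.
(* The point - x_1 = x_N itself is not in the outer region w < x_N; there the value is zero because
   it is a node. *)
move: xw; rewrite le_eqVlt => /predU1P[<-|xw].
  by rewrite -xN sawtooth_node//; lia.
by rewrite sawtooth_out// xN ltrN2 xw orbT.
Qed.

Lemma first_le_psum (n : nat) : (1 <= n < N)%N -> x 1%N <= psum x n.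
Proof.
move=> nN; have -> : x 1%N = psum x 1 by rewrite psumS psum0 add0r.
have [nm|nm] := leqP n.*2 N.+1; first by apply: (psum_le sol); lia.
by rewrite -(psum_sym sol (n := n)); [apply: (psum_le sol); lia|lia].
Qed.

Lemma sawtooth_le (w : R) : (1 < N)%N -> sawtooth N x w <= (x 1%N)^-1 / 2.
Proof.
move=> N1; have N1' : (1 <= 1 < N)%N by lia.
have x1 : 0 < x 1%N by have := psum_gt0 sol N1'; rewrite psumS psum0 add0r.
have [out|] := boolP ((x 1%N <= w) || (w < x N)).
  by rewrite sawtooth_out// divr_ge0// invr_ge0 ltW.
rewrite negb_or -ltNge -leNgt => /andP[wx xw].
have [n nN wn] : exists2 n, (1 <= n < N)%N & x n.+1 <= w <= x n.
  (* If no interval contained w, induction from w < x_1 would push w below every x_k, contradicting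
     x_N <= w. *)
  apply: contrapT => H.
  suff: w < x N by rewrite ltNge xw.
  have {1}-> : N = N.-1.+1 by lia.
  have : (N.-1 < N)%N by lia.
  elim: N.-1 => // k IH kN; have kw := IH (ltnW kN).
  rewrite ltNge; apply/negP => wk; apply: H; exists k.+1 => //.
  by rewrite wk ltW.
apply: (le_trans (sawtooth_le_gap nN wn)); rewrite ler_pM2r ?invr_gt0//.
by rewrite lef_pV2 ?posrE ?first_le_psum// (psum_gt0 sol nN).
Qed.

End Sawtooth.

(** * Expectation of a bounded function and harmonic sums *)

Lemma expectation_bounds (R : realType) (d : measure_display)
    (T : measurableType d) (P : probability T R) (X : T -> R) (B : R) :
  (forall t, 0 <= X t) -> (forall t, X t <= B) -> 0 <= fine 'E_P[X] <= B.
Proof.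
move=> X0 XB; have E0 : (0 <= 'E_P[X])%E by exact: expectation_ge0.
have EB : ('E_P[X] <= B%:E)%E.
  (* For nonnegative functions the integral is a supremum over simple functions below, hence
     monotone. *)
  rewrite -(expectation_cst P) unlock !ge0_integralTE//; last first.
  - by move=> t; rewrite lee_fin (le_trans (X0 t)).
  - apply: le_ereal_sup => _ [g gX <-]; exists g => // t.
    by rewrite (le_trans (gX t))// lee_fin.
by rewrite fine_ge0//=; move: E0 EB; case: ('E_P[X])%E.
Qed.

Lemma harmonic_le_sqrt (R : realType) (n : nat) :
  psum (fun k => k%:R^-1 : R) n <= 2 * Num.sqrt n%:R.
Proof.
elim: n => [|n IH]; first by rewrite psum0 sqrtr0 mulr0.
rewrite psumS; apply: (le_trans (lerD IH (lexx _))).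
set s := Num.sqrt n%:R; set t := Num.sqrt n.+1%:R.
have s0 : 0 <= s by exact: sqrtr_ge0.
have t0 : 0 < t by rewrite sqrtr_gt0 ltr0n.
have t1 : 1 <= t by rewrite -sqrtr1 ler_sqrt// ler1n.
have sE : s ^+ 2 = n%:R by rewrite sqr_sqrtr.
have tE : t ^+ 2 = n.+1%:R by rewrite sqr_sqrtr.
have st : s <= t by rewrite ler_sqrt// ler_nat.
have tsE : t ^+ 2 = s ^+ 2 + 1 by rewrite sE tE natr1.
rewrite -tE -lerBrDl -[_^-1]mul1r ler_pdivrMr ?exprn_gt0//.
(* Indeed 2 t >= t + s and (t - s)(t + s) = 1; the spare factor t is at least 1. *)
suff : 1 <= 2 * (t - s) * t by move=> H; nra.
by nra.
Qed.

(** * The bound on a single window x_{n+1} < w <= x_n *)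

Section Window.
Variables (R : realType) (N : nat) (x : nat -> R).
Hypothesis sol : decreasing_solution N x.
Variables (h : R -> R) (c : R) (f : R -> R).
Hypothesis stein : bounded_stein_solution h c f.
Hypothesis h0 : forall t, 0 <= h t.
Hypothesis c0 : 0 <= c.
Hypothesis h_out : forall t, x 1%N <= t -> h t = 0.
Hypothesis h_gap : forall (j : nat) (t : R), (1 <= j < N)%N ->
  x j.+1 <= t <= x j -> h t <= (psum x j)^-1 / 2.

Lemma gauss_solution_le (i j : nat) : (1 <= i)%N -> (i <= j)%N -> (j <= N)%N ->
  gauss (x i) * psum x j <= gauss (x j) * psum x i.
Proof.
move=> i1 ij jN; have := psum_expR_le sol i1 ij jN.
rewrite /gauss !expRN => H.
rewrite [leLHS]mulrC [leRHS]mulrC ler_pdivrMr ?expR_gt0//.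
by rewrite mulrAC ler_pdivlMr ?expR_gt0.
Qed.

(** Descending from x_1, where the excess is nonnegative, tooth i + 1 costs at most gauss(x_{i+2}) /
    (2 S_{i+1}^2). Comparison of gauss(x_{i+2}) with gauss(x_n), together with S_{i+1} >= (i + 1)
    x_n, turns this cost into a multiple of 1 / (i + 1). *)
Lemma stein_excess_node_ge (n i : nat) : (n < N)%N -> 0 < x n -> (i < n)%N ->
  - (gauss (x n) / (psum x n * x n) * psum (fun k => k%:R^-1) i)
    <= gauss (x i.+1) * stein_excess c f (x i.+1).
Proof.
move=> nN xn0; have Sn : (0 < n)%N -> 0 < psum x n.
  by move=> n0; apply: (psum_gt0 sol); rewrite n0.
elim: i => [n0|i IH iN].
  rewrite psum0 mulr0 oppr0 mulr_ge0 ?(ltW (gauss_gt0 _))//.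
  apply: (stein_excess_ge0 stein c0) => //.
  by apply: (le_trans (ltW xn0)); apply: (solution_le sol); lia.
have {IH} := IH (ltnW iN); have {Sn} := Sn ltac:(lia).
have iN' : (1 <= i.+1 < N)%N by lia.
have S0 := psum_gt0 sol iN'.
have xi1 : x i.+2 <= x i.+1 by apply/ltW/(solution_decr sol).
have xni : x n <= x i.+2 by apply: (solution_le sol); lia.
have := @stein_excess_increment_le _ _ _ _ stein c0 (x i.+2) (x i.+1)
  ((psum x i.+1)^-1 / 2).
move=> /(_ (le_trans (ltW xn0) xni) xi1) /(_ ltac:(by rewrite divr_ge0// invr_ge0 ltW)).
move=> /(_ (fun t => h_gap iN')); rewrite (solution_gap sol iN').
have := @gauss_solution_le i.+2 n isT iN (ltnW nN).
have := @ler_natM_psum _ _ _ i.+1 sol (ltnW (andP iN').2).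
rewrite (psumS x i.+1) (psumS (fun k => k%:R^-1 : R) i).
set S := psum x i.+1 in S0 *; set Sn := psum x n; set g2 := gauss (x i.+2).
set gn := gauss (x n); set H := psum (fun k => k%:R^-1) i.
move=> iS gS incr Sn0 IH.
have i1 : 1 <= i.+1%:R :> R by rewrite ler1n.
have xi0 : 0 < x i.+1 by lra.
have xiS : x i.+1 <= S by apply: (le_trans _ iS); rewrite ler_peMl// ltW.
have gn0 : 0 < gn by exact: gauss_gt0.
(* Here S_{i+2} = S_{i+1} + x_{i+2} <= 2 S_{i+1}. *)
have gS2 : g2 * Sn <= gn * (2 * S).
  by apply: (le_trans gS); rewrite ler_pM2l//; lra.
suff : g2 * (S^-1 / 2) * S^-1 <= gn / (Sn * x n) * i.+1%:R^-1.
  move: IH incr; rewrite [_ * (H + _)]mulrDr.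
  move: (g2 * (S^-1 / 2) / S) (gn / (Sn * x n) * H) (gn / (Sn * x n) / i.+1%:R).
  by move=> a b e; lra.
apply: (@le_trans _ _ (gn * (2 * S) / Sn * (S^-1 / 2) * S^-1)).
  rewrite !ler_wpM2r ?divr_ge0 ?invr_ge0 ?(ltW S0)//.
  by rewrite ler_pdivlMr.
have -> : gn * (2 * S) / Sn * (S^-1 / 2) * S^-1 = gn / Sn * S^-1.
  by field; rewrite !gt_eqF.
rewrite invfM mulrA -[leRHS]mulrA -invfM ler_pM2l ?divr_gt0//.
rewrite lef_pV2 ?posrE ?mulr_gt0 ?ltr0n//; apply: le_trans iS.
by rewrite mulrC ler_pM2l ?ltr0n//; lra.
Qed.

(** From the node x_n one descends into tooth n as far as w. This last piece supplies the term 1 / n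
    that completes the harmonic sum, and S_n >= n x_n removes S_n. *)
Lemma stein_excess_ge (n : nat) (w : R) : (1 <= n < N)%N -> 0 < x n.+1 ->
  x n.+1 < w -> w <= x n ->
  - (2 / (Num.sqrt n%:R * x n ^+ 2)) <= stein_excess c f w.
Proof.
move=> nN x0 xw wx; have w0 : 0 < w by lra.
have xn0 : 0 < x n by lra.
have S0 := psum_gt0 sol nN.
have := @stein_excess_node_ge n n.-1 (andP nN).2 xn0 ltac:(lia).
have -> : n.-1.+1 = n by lia.
have := @stein_excess_increment_le _ _ _ _ stein c0 w (x n)
  ((psum x n)^-1 / 2) (ltW w0) wx ltac:(by rewrite divr_ge0// invr_ge0 ltW).
have hw t : w <= t <= x n -> h t <= (psum x n)^-1 / 2.
  by move=> /andP[wt tx]; apply: h_gap => //; rewrite tx andbT; lra.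
move=> /(_ hw).
have xwS : x n - w <= (psum x n)^-1 by rewrite -(solution_gap sol nN); lra.
have := @harmonic_le_sqrt R n; have {1}-> : n = n.-1.+1 by lia.
rewrite psumS; have -> : n.-1.+1 = n by lia.
have nS := @ler_natM_psum _ _ _ n sol (ltnW (andP nN).2).
set S := psum x n in S0 xwS nS *; set H := psum _ _; set s := Num.sqrt _.
have sE : s ^+ 2 = n%:R by rewrite sqr_sqrtr.
have n0 : 0 < n%:R :> R by rewrite ltr0n; lia.
have s0 : 0 < s by rewrite sqrtr_gt0.
have H0 : 0 <= H by apply: sumr_ge0 => k _; rewrite invr_ge0.
move=> Hs incr node; rewrite -(ler_pM2l (gauss_gt0 w)).
have gw0 := gauss_gt0 w; have gnw : gauss (x n) <= gauss w by rewrite gauss_decr// ltW.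
have node' : - (gauss w / (S * x n) * H) <= gauss (x n) * stein_excess c f (x n).
  apply: le_trans node; rewrite lerN2 !ler_wpM2r// invr_ge0 mulr_ge0// ltW//.
have incr' : gauss w * (S^-1 / 2) * (x n - w) <= gauss w / (S * x n) * n%:R^-1.
  rewrite invfM -!mulrA ler_pM2l// ler_pM2l ?invr_gt0//.
  apply: (@le_trans _ _ S^-1); first by rewrite mulrC; have := invr_gt0 S; lra.
  by rewrite -invfM lef_pV2 ?posrE ?mulr_gt0// mulrC.
suff : gauss w / (S * x n) * (H + n%:R^-1) <= gauss w * (2 / (s * x n ^+ 2)) by lra.
rewrite -mulrA ler_pM2l//.
apply: (@le_trans _ _ ((S * x n)^-1 * (2 * s))).
  by rewrite ler_pM2l// invr_gt0 mulr_gt0.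
have -> : 2 / (s * x n ^+ 2) = (n%:R * x n * x n)^-1 * (2 * s).
  by rewrite -sE; field; rewrite !gt_eqF.
rewrite ler_pM2r ?mulr_gt0// lef_pV2 ?posrE ?mulr_gt0//.
by rewrite ler_pM2r.
Qed.

Lemma stein_window_bound (n : nat) (w : R) : (1 <= n < N)%N -> 0 < x n.+1 ->
  c <= (x 1%N)^-1 / 2 -> x n.+1 < w -> w <= x n ->
  `|(1 + w ^+ 2) * f w + w * (h w - c)|
    <= (x n.+1 ^+ 2)^-1 / 2 + 2 * (1 + (x n ^+ 2)^-1) / Num.sqrt n%:R.
Proof.
move=> nN x0 cx xw wx; have w0 : 0 < w by lra.
have xn0 : 0 < x n by lra.
have S0 := psum_gt0 sol nN.
have xn1 : x n <= x 1%N by apply: (solution_le sol); lia.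
have nS := @ler_natM_psum _ _ _ n sol (ltnW (andP nN).2).
have n1 : 1 <= n%:R :> R by rewrite ler1n; lia.
have := @stein_excess_ge n w nN x0 xw wx; rewrite /stein_excess.
set s := Num.sqrt _.
have sE : s ^+ 2 = n%:R by rewrite sqr_sqrtr.
have s0 : 0 < s by rewrite sqrtr_gt0; lra.
have q0 : 0 < 1 + w ^+ 2 by rewrite ltr_wpDr// sqr_ge0.
have hw : h w <= (psum x n)^-1 / 2 by apply: h_gap => //; rewrite wx ltW.
have whw : 0 <= w * h w by rewrite mulr_ge0// ltW.
move=> lo; rewrite ler_norml; apply/andP; split.
  have w2 : w ^+ 2 <= x n ^+ 2 by rewrite lerXn2r// nnegrE ltW.
  (* The right-hand side is (1 + w^2) times the excess and equals g_h(w) - w h(w), where w h(w) >=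
     0. *)
  have lo' : - (2 * (1 + (x n ^+ 2)^-1) / s) <= (1 + w ^+ 2) * f w - c * w.
    have -> : (1 + w ^+ 2) * f w - c * w
        = (1 + w ^+ 2) * (f w - c * (w / (1 + w ^+ 2))).
      by field; rewrite gt_eqF.
    have -> : - (2 * (1 + (x n ^+ 2)^-1) / s)
        = (1 + x n ^+ 2) * - (2 / (s * x n ^+ 2)).
      by field; rewrite !gt_eqF.
    apply: (@le_trans _ _ ((1 + w ^+ 2) * - (2 / (s * x n ^+ 2)))).
      rewrite !mulrN lerN2; apply: ler_wpM2r; last by rewrite lerD2l.
      by rewrite divr_ge0// mulr_ge0 ?sqr_ge0// ltW.
    by rewrite ler_pM2l.
  have : 0 <= (x n.+1 ^+ 2)^-1 by rewrite invr_ge0 sqr_ge0.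
  by lra.
(* Since (1 + w^2) c / w = c / w + c w, the large term c w cancels. *)
have up1 : (1 + w ^+ 2) * f w - c * w <= c / w.
  have := stein_le stein h0 c0 w0; rewrite -(ler_pM2l q0).
  have -> : (1 + w ^+ 2) * (c / w) = c / w + c * w by field; rewrite gt_eqF.
  by lra.
have up2 : c / w <= (x n.+1 ^+ 2)^-1 / 2.
  apply: (@le_trans _ _ ((x n.+1)^-1 / 2 / w)).
    rewrite ler_pM2r ?invr_gt0//; apply: (le_trans cx).
    by rewrite ler_pM2r ?invr_gt0// lef_pV2 ?posrE//; lra.
  rewrite expr2 invfM mulrAC ler_pM2r ?invr_gt0// ler_pM2l ?invr_gt0//.
  by rewrite lef_pV2 ?posrE// ltW.
have up3 : w * h w <= s^-1.
  apply: (@le_trans _ _ (x n * ((psum x n)^-1 / 2))).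
    by apply: ler_pM => //; exact: ltW.
  have s1 : 1 <= s by rewrite -sqrtr1 ler_sqrt//; lra.
  have n0 : 0 < n%:R :> R by lra.
  have xS : x n / psum x n <= n%:R^-1.
    by rewrite ler_pdivrMr// mulrC ler_pdivlMr// mulrC.
  have ns : n%:R^-1 <= s^-1 by rewrite lef_pV2 ?posrE// -sE expr2 ler_peMl// ltW.
  have : 0 <= x n / psum x n by rewrite divr_ge0// ltW.
  by rewrite mulrA; move: xS; move: (x n / psum x n) => r; lra.
have : 0 <= (x n ^+ 2)^-1 / s by rewrite divr_ge0 ?invr_ge0 ?sqr_ge0// ltW.
have : 0 <= s^-1 by rewrite invr_ge0 ltW.
by lra.
Qed.

End Window.

(** * Reflection of the Stein equation and logarithmic growth of x_n^2 *)

Lemma bounded_stein_solution_opp (R : realType) (h : R -> R) (c : R)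
    (f : R -> R) : bounded_stein_solution h c f ->
  bounded_stein_solution (fun t => h (- t)) c (fun t => - f (- t)).
Proof.
move=> sol.
have D (t : R) : is_derive t 1 (fun s : R => - f (- s))
    (- t * f (- t) + (h (- t) - c)).
  have DN : is_derive t 1 (fun s : R => - s) (- 1 : R).
    exact: is_deriveN (is_derive_id t 1).
  have Df := @is_derive1_comp _ f (fun s : R => - s) t _ _
    (is_derive_stein sol (- t)) DN.
  by apply: (is_derive_eq (is_deriveN Df)); rewrite mulrN1 opprK.
split.
- by have [M fM] := stein_bounded sol; exists M => t; rewrite normrN.
- by move=> t; have [] := D t.
- by move=> t; rewrite derive1E (@derive_val _ _ _ _ _ _ _ (D t)); ring.
Qed.

Lemma expR3_bounds (R : realType) : 11 <= expR (3 : R) <= 32.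
Proof.
apply/andP; split.
  have -> : 3 = 6%:R * 2^-1 :> R by lra.
  (* The bounds come from e^{1/2} >= 3/2 and, below, e^{-1/4} >= 3/4. *)
  rewrite expRM_natl; apply: (@le_trans _ _ ((3 / 2) ^+ 6)); first by lra.
  have := @expR_ge1Dx R 2^-1.
  by move=> H; rewrite lerXn2r ?nnegrE ?expR_ge0//; lra.
have : expR 3 * expR (- 4^-1) ^+ 12 = 1 :> R.
  rewrite -expRM_natl -expRD.
  by have -> : 3 + 12%:R * - 4^-1 = 0 :> R; [lra | rewrite expR0].
have : (3 / 4) ^+ 12 <= expR (- 4^-1) ^+ 12 :> R.
  have := @expR_ge1Dx R (- 4^-1).
  by move=> H; rewrite lerXn2r ?nnegrE ?expR_ge0//; lra.
by move=> /(ler_wpM2l (expR_ge0 3)) H E; move: H; rewrite E; lra.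
Qed.

Lemma ln_le_sqr_solution (R : realType) (N m n : nat) (x : nat -> R) :
  decreasing_solution N x -> (N <= m.*2)%N -> (m.*2 <= N.+1)%N -> (m < N)%N ->
  (50 < m)%N -> (1 <= n)%N -> n.+1%:R * expR 3 <= m%:R :> R ->
  3 <= ln (m%:R / n%:R : R) <= 8 * x n.+1 ^+ 2.
Proof.
move=> sol Nm mN mN' m50 n1 nm.
have n0 : 0 < n%:R :> R by rewrite ltr0n.
have nS : n.+1%:R = n%:R + 1 :> R by rewrite natr1.
have n1R : 1 <= n%:R :> R by rewrite ler1n.
have m50R : 51 <= m%:R :> R by rewrite (ler_nat _ 51).
have /andP[e11 e32] := expR3_bounds R.
have mn0 : 0 < m%:R / n%:R :> R by rewrite divr_gt0//; lra.
have n11 : 11 * n.+1%:R <= m%:R :> R.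
  by apply: le_trans nm; rewrite mulrC ler_pM2l ?ltr0n.
apply/andP; split.
  rewrite -(@expRK R 3) ler_ln ?posrE ?expR_gt0// ler_pdivlMr// mulrC.
  by apply: le_trans nm; rewrite ler_pM2r ?expR_gt0// ler_nat.
have nm' : (1 <= n.+1 <= m)%N.
  by rewrite /= -(ler_nat R); lra.
rewrite -[leRHS](@expRK R) ler_ln ?posrE ?expR_gt0//.
(* After exponentiation the claim is m / n <= E^8. As m - 1 >= 4 m / 5, E is at least r; moreover m
   / n <= 2 m / (n + 1) = 10 r, and r >= 11 / 5 gives r^7 >= 10. *)
have := expR_sqr_solution_ge sol Nm mN mN' nm'.
rewrite expRM_natl; set E := expR _ => H.
pose r : R := m%:R / (5 * n.+1%:R).
have rE : r <= E.
  rewrite /r ler_pdivrMr ?mulr_gt0 ?ltr0n//; lra.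
have r2 : 11 / 5 <= r.
  rewrite /r ler_pdivlMr ?mulr_gt0 ?ltr0n//; lra.
apply: (@le_trans _ _ (10 * r)).
  rewrite ler_pdivrMr// /r mulrA mulrAC ler_pdivlMr ?mulr_gt0 ?ltr0n//.
  have : 0 <= (n%:R - 1) * m%:R :> R by rewrite mulr_ge0//; lra.
  by rewrite nS; lra.
apply: (@le_trans _ _ (r ^+ 8)); last by rewrite lerXn2r ?nnegrE//; lra.
rewrite exprSr ler_pM2r; last by lra.
apply: (@le_trans _ _ ((11 / 5) ^+ 7)); first by lra.
by rewrite lerXn2r ?nnegrE//; lra.
Qed.

(** * Combination of the window bound with the logarithmic growth *)

Theorem lemma4p1 (R : realType) :
  exists2 C : R, 0 < C &
    forall (N : nat) (x : nat -> R),
    (100 < N)%N -> decreasing_solution N x ->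
    let m : nat := if odd N then N.+1./2 else N./2 in
    let h : R -> R := sawtooth N x in
    forall (d : measure_display) (T : measurableType d) (P : probability T R)
      (Z : {RV P >-> R}),
    standard_normal Z ->
    forall fh : R -> R, bounded_stein_solution h (fine 'E_P[h \o Z]) fh ->
    let gh : R -> R := derive1 (fun u : R => u * fh u) in
    let k : nat := Num.truncn (m%:R / expR 3 : R) in
    forall (n : nat) (w : R), (1 <= n)%N -> (n < N)%N ->
      (x k <= x n.+1 /\ x n.+1 < w /\ w <= x n) \/
      (- x n <= w /\ w < - x n.+1 /\ - x n.+1 <= - x k) ->
      `|gh w| <= C * (1 / ln (m%:R / n%:R) + 1 / (n%:R `^ (2 / 9))).
Proof.
(* The constant must cover 4 from 1 / (2 x_{n+1}^2) <= 4 / L and 2 (1 + 8/3) = 22/3 from the other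
   term. *)
exists 8 => // N x N100 sol m h d T P Z _ fh stein gh k n w n1 nN xw.
have mN : (m.*2 <= N.+1)%N by rewrite /m; case: ifP; lia.
have Nm : (N <= m.*2)%N by rewrite /m; case: ifP; lia.
clearbody m; have mN' : (m < N)%N by lia.
have m50 : (50 < m)%N by lia.
have N1 : (1 < N)%N by lia.
have nN' : (1 <= n < N)%N by rewrite n1.
have h0 t : 0 <= h t by exact: sawtooth_ge0.
have /andP[c0 cx] : 0 <= fine 'E_P[h \o Z] <= (x 1%N)^-1 / 2.
  by apply: expectation_bounds => t; [exact: h0 | exact: sawtooth_le].
set c := fine _ in stein c0 cx.
have /andP[e11 e32] := expR3_bounds R.
have e0 : 0 < expR 3 :> R by exact: expR_gt0.
have m51 : 51 <= m%:R :> R by rewrite (ler_nat _ 51).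
(* As m >= 51 > 32 >= e^3, the index k is positive and [x k] is a genuine term of the solution. *)
have k1 : (1 <= k)%N by rewrite truncn_gt0 ler_pdivlMr//; lra.
have km : k%:R * expR 3 <= m%:R :> R.
  by rewrite -ler_pdivlMr// truncn_le divr_ge0// ltW.
clearbody k; have kN : (k <= N)%N.
  have : k%:R <= m%:R :> R.
    by apply: le_trans km; rewrite ler_peMr//; lra.
  by rewrite ler_nat => km'; exact: leq_trans km' (ltnW mN').
have xkn : x k <= x n.+1 by case: xw => [[]|[_ [_]]] //; rewrite lerN2.
have nk : (n.+1 <= k)%N.
  rewrite leqNgt; apply/negP => kn.
  by have := solution_lt sol k1 kn nN; rewrite ltNge xkn.
have nm : n.+1%:R * expR 3 <= m%:R :> R.
  by apply: le_trans km; rewrite ler_pM2r// ler_nat.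
have /andP[ln3 lnx] := ln_le_sqr_solution sol Nm mN mN' m50 n1 nm.
set L := ln _ in ln3 lnx *.
have xn1 : 0 < x n.+1.
  have xge0 : 0 <= x n.+1.
    apply: (solution_ge0 sol) => //.
    have : n.+1%:R <= m%:R :> R.
      by apply: le_trans nm; rewrite ler_peMr//; lra.
    by rewrite ler_nat => nm'; apply: leq_trans mN; rewrite leq_double.
  rewrite lt_neqAle xge0 andbT; apply/eqP => x0.
  by move: lnx; rewrite -x0 expr0n/=; lra.
have xnn : x n.+1 < x n by exact: (solution_decr sol).
have bound : `|gh w| <= (x n.+1 ^+ 2)^-1 / 2
    + 2 * (1 + (x n ^+ 2)^-1) / Num.sqrt n%:R.
  rewrite /gh (derive1_id_stein stein).
  case: xw => [[_ [xw wx]]|[xw [wx _]]].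
    apply: (stein_window_bound sol stein h0 c0) => //.
    - by move=> t xt; rewrite /h sawtooth_out// xt.
    - by move=> j t jN tj; exact: sawtooth_le_gap.
  (* For negative w the bound is applied at - w to the reflected solution, which only flips the sign
     of g_h. *)
  have := @stein_window_bound _ _ _ sol (fun t => h (- t)) c (fun t => - fh (- t))
    (bounded_stein_solution_opp stein) (fun t => h0 (- t)) c0.
  move=> /(_ _ _ n (- w) nN' xn1 cx); rewrite !opprK sqrrN.
  rewrite mulrN mulNr -opprD normrN; apply.
  - by move=> t xt; apply: (sawtooth_opp_out sol); first exact: ltnW.
  - by move=> j t jN tj; exact: (sawtooth_opp_le_gap sol).
  - by lra.
  - by lra.
apply: (le_trans bound).
set s := Num.sqrt _; set q := _ `^ _.
have n1R : 1 <= n%:R :> R by rewrite ler1n.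
have q0 : 0 < q by rewrite powR_gt0//; lra.
have s0 : 0 < s by rewrite sqrtr_gt0; lra.
(* The window bound decays like n^{-1/2}, faster than the exponent 2/9 demands. *)
have sq : s^-1 <= q^-1.
  rewrite lef_pV2 ?posrE// /s -powR12_sqrt; last lra.
  by apply: ler_powR => //; lra.
have X0 : 0 < x n.+1 ^+ 2 by rewrite exprn_gt0.
have XL : (x n.+1 ^+ 2)^-1 <= 8 * L^-1.
  rewrite -[_^-1]mul1r ler_pdivrMr// mulrAC ler_pdivlMr ?mul1r//; lra.
have X8 : (x n ^+ 2)^-1 <= 8 / 3.
  rewrite -[_^-1]mul1r ler_pdivrMr ?exprn_gt0//; last lra.
  have : x n.+1 ^+ 2 <= x n ^+ 2 by rewrite lerXn2r ?nnegrE//; lra.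
  by lra.
have : 2 * (1 + (x n ^+ 2)^-1) / s <= 8 * q^-1.
  by apply: ler_pM => //; [rewrite mulr_ge0// addr_ge0// invr_ge0 sqr_ge0
    | rewrite invr_ge0 ltW | lra].
have : 0 <= L^-1 by rewrite invr_ge0; lra.
by rewrite !div1r; lra.
Qed.
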